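(* Let $D\mapsto f_D$ be a functional summary with $f_D\in\mathcal{H}_{1,C}$ for all $D\in\mathcal{D}$, and suppose the global sensitivity $\Delta=\sup_{D\sim D'}\|f_D-f_{D'}\|_{1,C}$ (supremum over adjacent pairs) satisfies $0<\Delta<\infty$. Let $\epsilon>0$, $\sigma=\sqrt2\,\Delta/\epsilon$, and let $Z$ be an ICLP with mean $0$ and covariance operator $C$. Then the mechanism releasing $\tilde f_D=f_D+\sigma Z$ satisfies $\epsilon$-differential privacy.
   Context: $\mathbb{H}$ is a real separable infinite-dimensional Hilbert space. $C$ is a covariance operator on $\mathbb{H}$ with eigenvalues $\lambda_1\ge\lambda_2\ge\dots>0$ and eigenvectors $\{\phi_j\}_{j\ge1}$ forming an orthonormal basis of $\mathbb{H}$; $h_j=\langle h,\phi_j\rangle$. $\|h\|_{1,C}=\sum_j|h_j|/\sqrt{\lambda_j}$, $\mathcal{H}_{1,C}=\{h:\|h\|_{1,C}<\infty\}$. An ICLP with mean $\mu$ and covariance operator $C$ is the random element $\mu+\sum_{j\ge1}\sqrt{\lambda_j}Z_j\phi_j$ (series converging in $L^2(\Omega;\mathbb{H})$), where $Z_j$ are i.i.d. Laplace with mean $0$ and variance $1$, i.e. with density $\frac1{\sqrt2}e^{-\sqrt2|x|}$ (with this normalization the scale factor is $\sqrt2\Delta/\epsilon$; the paper writes $\Delta/\epsilon$ with Laplace-scale normalization). Datasets $D,D'$ are adjacent ($D\sim D'$) if they differ in exactly one record. The mechanism is $\epsilon$-differentially private if $P_D(A)\le e^{\epsilon}P_{D'}(A)$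 for all adjacent $D,D'$ and all Borel $A\subseteq\mathbb{H}$, where $P_D$ is the law of $\tilde f_D$. *)

(* Defs.v *)
From HB Require Import structures.
From mathcomp Require Import all_boot all_order all_algebra.
From mathcomp Require Import all_classical all_reals all_analysis.
Set Implicit Arguments. Unset Strict Implicit. Unset Printing Implicit Defensive.
Import Order.TTheory GRing.Theory Num.Theory.
Import numFieldNormedType.Exports.
Local Open Scope classical_set_scope.
Local Open Scope ring_scope.

Definition borel_sets (T : topologicalType) : set (set T) :=
  <<s [set U : set T | open U] >>.

Definition is_inner_product (R : realType) (H : normedModType R)
    (ip : H -> H -> R) : Prop :=
  [/\ forall x y, ip x y = ip y x,
      forall (a : R) x y z, ip (a *: x + y) z = a * ip x z + ip y z &
      forall x, ip x x = `|x| ^+ 2].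

Definition orthonormal_basis (R : realType) (H : normedModType R)
    (ip : H -> H -> R) (phi : nat -> H) : Prop :=
  (forall i j, ip (phi i) (phi j) = (i == j)%:R) /\
  (forall h, (fun n : nat => \sum_(j < n) ip h (phi j) *: phi j) @ \oo --> h).

Definition covariance_operator_eigen (R : realType) (H : normedModType R)
    (ip : H -> H -> R) (C : H -> H) (lam : nat -> R) (phi : nat -> H) : Prop :=
  [/\ (forall (a : R) x y, C (a *: x + y) = a *: C x + C y) /\ continuous C,
      orthonormal_basis ip phi,
      forall j, C (phi j) = lam j *: phi j,
      (forall j, 0 < lam j) /\ (forall j, lam j.+1 <= lam j) &
      (\sum_(j <oo) (lam j)%:E < +oo)%E].

Definition norm1C (R : realType) (H : normedModType R)
    (ip : H -> H -> R) (lam : nat -> R) (phi : nat -> H) (h : H) : \bar R :=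
  (\sum_(j <oo) (`|ip h (phi j)| / Num.sqrt (lam j))%:E)%E.

(* density of the Laplace law with mean 0 and variance 1 *)
Definition laplace_pdf (R : realType) (x : R) : R :=
  (Num.sqrt 2)^-1 * expR (- (Num.sqrt 2 * `|x|)).

Definition mutually_independent (d : measure_display) (Omega : measurableType d)
    (R : realType) (P : probability Omega R) (Z : nat -> Omega -> R) : Prop :=
  forall (s : seq nat) (A : nat -> set R), uniq s ->
    (forall i, measurable (A i)) ->
    P (\bigcap_(i in [set` s]) (Z i @^-1` A i)) =
    (\prod_(i <- s) P (Z i @^-1` A i))%E.

Definition is_ICLP (d : measure_display) (Omega : measurableType d)
    (R : realType) (P : probability Omega R) (H : normedModType R)
    (mu : H) (lam : nat -> R) (phi : nat -> H) (X : Omega -> H) : Prop :=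
  exists Z : nat -> Omega -> R,
   [/\ forall j, measurable_fun setT (Z j),
       mutually_independent P Z,
       forall j (A : set R), measurable A ->
         P (Z j @^-1` A) = (\int[lebesgue_measure]_(x in A) (laplace_pdf x)%:E)%E,
       forall A, borel_sets A -> measurable (X @^-1` A) &
       (fun n : nat => (\int[P]_w
           (`|X w - (mu + \sum_(j < n) (Num.sqrt (lam j) * Z j w) *: phi j)|
              ^+ 2)%:E)%E) @ \oo --> 0%E].

Definition adjacent_datasets (Rec : Type) (D D' : seq Rec) : Prop :=
  size D = size D' /\
  exists i, [/\ (i < size D)%N, onth D i <> onth D' i &
                forall j, j <> i -> onth D j = onth D' j].

Definition sensitivity (R : realType) (H : normedModType R)
    (ip : H -> H -> R) (lam : nat -> R) (phi : nat -> H)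
    (Rec : Type) (Dom : set (seq Rec)) (f : seq Rec -> H) : \bar R :=
  ereal_sup [set x | exists D D', [/\ Dom D, Dom D', adjacent_datasets D D' &
                                     x = norm1C ip lam phi (f D - f D')]].

(* Main.v *)
(* In the basis phi the released element has independent coordinates, the j-th
   one being a Laplace variable of scale sigma * sqrt (lam j) centred at the
   j-th coordinate of f D.  Translating a Laplace law changes its density by a
   factor at most exp (sqrt 2 |shift| / scale), and these exponents sum to at
   most eps, so the two output laws satisfy the privacy inequality on cylinders
   with measurable sides.  Cylinders form a semiring of sets; since a finite
   measure is recovered on the generated sigma-algebra as an infimum over
   countable covers by semiring elements, the inequality propagates to it.
   Finally, Parseval makes the norm measurable with respect to the coordinates,
   and rational finite combinations of phi are dense, so every open set is a
   countable union of balls in that sigma-algebra. *)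
Require Import Defs.
From HB Require Import structures.
From mathcomp Require Import all_boot all_order all_algebra.
From mathcomp Require Import all_classical all_reals all_analysis.
From mathcomp Require Import measurable_realfun ring.
Import Order.TTheory GRing.Theory Num.Theory.
Import numFieldNormedType.Exports.
Set Implicit Arguments.
Unset Strict Implicit.
Unset Printing Implicit Defensive.
Local Open Scope classical_set_scope.
Local Open Scope ring_scope.

(** * Comparing measures through a generating semiring *)

Section semiring_comparison.
Context d (T : semiRingOfSetsType d) (R : realType).
Notation I := (g_sigma_algebraType (@measurable d T)).
Local Open Scope ereal_scope.

Section restriction.
Variable m : {measure set I -> \bar R}.

Definition semiring_restr : set T -> \bar R := m.

Let restr0 : semiring_restr set0 = 0.
Proof. exact: measure0. Qed.

Let restr_ge0 A : 0 <= semiring_restr A.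
Proof. exact: measure_ge0. Qed.

Let restr_sigma_additive : semi_sigma_additive semiring_restr.
Proof.
move=> F mF tF mUF; apply: (@measure_semi_sigma_additive _ _ _ m) => //.
- by move=> i; apply: sub_sigma_algebra; exact: mF.
- exact: sub_sigma_algebra.
Qed.

HB.instance Definition _ := isMeasure.Build _ _ _ semiring_restr
  restr0 restr_ge0 restr_sigma_additive.

End restriction.

(** By uniqueness of the extension, [m2 A] is the infimum of the sums of [m2 (F i)] over countable
    semiring covers [F] of [A]. Each such sum dominates that of [m1 (F i)], hence [m1 A]. *)
Lemma le_measure_semiring (m1 m2 : {measure set I -> \bar R}) :
  sigma_finite [set: T] (semiring_restr m2) ->
  (forall A, d.-measurable A -> m1 A <= m2 A) ->
  forall A, (d.-measurable).-sigma.-measurable A -> m1 A <= m2 A.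
Proof.
move=> m2fin m12 A mA.
rewrite -(@measure_extension_unique _ _ _ (semiring_restr m2) m2fin m2)//.
apply: le_ereal_inf_tmp => _ [F [mF AF] <-].
have mF' i : measurable (F i : set I) by apply: sub_sigma_algebra; exact: mF.
apply: (@le_trans _ _ (m1 (\bigcup_i F i))).
  by apply: le_measure; rewrite ?inE//; exact: bigcupT_measurable.
apply: (@le_trans _ _ (\sum_(i <oo) m1 (F i))).
  by apply: measure_sigma_subadditive => //; exact: bigcupT_measurable.
by apply: lee_nneseries => i // _; exact: m12.
Qed.

End semiring_comparison.

(** * The semiring of cylinders *)

Section cylinders.
Context d' (T' : measurableType d') (T : pointedType) (c : nat -> T -> T').

(** Sides are indexed by all of [nat] and eventually trivial, so two cylinders intersect side by
    side even when their lengths differ. *)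
Definition cylinders : set (set T) := [set A | exists B : nat -> set T',
  [/\ forall j, measurable (B j), exists n, forall j, (n <= j)%N -> B j = setT &
      A = \bigcap_j (c j @^-1` B j)]].

Lemma cylindersI : setI_closed cylinders.
Proof.
move=> _ _ [B [mB [n Bn] ->]] [B' [mB' [m Bm] ->]].
exists (fun j => B j `&` B' j); split.
- by move=> j; exact: measurableI.
- exists (maxn n m) => j; rewrite geq_max => /andP[nj mj].
  by rewrite Bn// Bm// setIT.
- by rewrite -bigcapI.
Qed.

Lemma cylinders0 : cylinders set0.
Proof.
exists (fun j => if j is 0 then set0 else setT); split.
- by case.
- by exists 1%N; case.
- by rewrite predeqE => x; split => // /(_ 0 I).
Qed.

Lemma cylindersT : cylinders setT.
Proof.
exists (fun=> setT); split; [by []| by exists 0|].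
by rewrite predeqE => x; split.
Qed.

Lemma cylinders_preimage j (B : set T') : measurable B ->
  cylinders (c j @^-1` B).
Proof.
move=> mB; exists (fun i => if i == j then B else setT); split.
- by move=> i; case: ifP.
- by exists j.+1 => i ji; rewrite gtn_eqF.
- rewrite predeqE => x; split => [Bx i _|/(_ j I)]; last by rewrite /= eqxx.
  by rewrite /preimage /=; case: eqP => [->|].
Qed.

(* A point outside a cylinder leaves it at a first coordinate, and the possible
   values of that coordinate partition the difference. *)
Lemma cylindersD : semi_setD_closed cylinders.
Proof.
move=> _ _ [B [mB [n Bn] ->]] [B' [mB' [m Bm] ->]].
pose E i j := B j `&` (if (j < i)%N then B' j else
                       if j == i then ~` B' j else setT).
pose F i := \bigcap_j (c j @^-1` E i j).
have FP i x : F i x -> forall j, B j (c j x) /\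
    ((j < i)%N -> B' j (c j x)) /\ (j = i -> ~ B' j (c j x)).
  move=> Fx j; case: (Fx j I) => Bx h; split => //.
  by move: h; case: ltngtP => [ji|ji|->] h; split => // jE; rewrite jE ltnn in ji.
exists (F @` `I_m); split.
- by apply: finite_image; exact: finite_II.
- move=> _ [i /= im <-]; exists (E i); split=> //.
    move=> j; apply: measurableI => //; case: ifP => // _.
    by case: ifP => // _; exact: measurableC.
  (* Here [i < m <= j], so the second factor of [E i j] is also trivial. *)
  exists (maxn n m) => j; rewrite geq_max => /andP[nj mj].
  rewrite /E Bn// setTI ltnNge (leq_trans (ltnW im) mj)/=.
  by rewrite gtn_eqF// (leq_trans im).
- rewrite bigcup_image; apply/seteqP; split => [x [Bx nB'x]|x [i /= im Fx]].
    have [i iP] : exists i, ~~ `[< B' i (c i x) >].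
      apply/not_existsP => h; apply: nB'x => j _; apply/asboolP.
      by apply/negPn/negP; exact: h.
    have ex : exists i, ~~ `[< B' i (c i x) >] by exists i.
    case: (ex_minnP ex) => k /asboolPn nBk kmin.
    exists k => /=.
      by rewrite ltnNge; apply/negP => mk; apply: nBk; rewrite Bm.
    move=> j _; split; first exact: Bx.
    case: ltngtP => // [jk|->//].
    apply/asboolP/negPn/negP => /kmin; by rewrite leqNgt jk.
  split => [j _|/(_ i I)]; first by have [] := FP _ _ Fx j.
  by have [_ [_]] := FP _ _ Fx i; exact.
(* At the smaller of two distinct indices, one piece lies outside [B'] and the other inside. *)
- move=> _ _ [i /= im <-] [k /= km <-] [x [Fix Fkx]]; congr F.
  case: (ltngtP i k) => // ik.
    by have [_ [_ /(_ erefl)]] := FP _ _ Fix i; have [_ [/(_ ik)]] := FP _ _ Fkx i.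
  by have [_ [_ /(_ erefl)]] := FP _ _ Fkx k; have [_ [/(_ ik)]] := FP _ _ Fix k.
Qed.

(* The phantom [c] lets the semiring structure be inferred from the type. *)
Definition cylinder_type : Type := let _ := c in T.

HB.instance Definition _ := Pointed.copy cylinder_type T.

Definition cylinder_display : measure_display.
Proof. exact: sigma_display cylinders. Qed.

HB.instance Definition _ := @isSemiRingOfSets.Build cylinder_display
  cylinder_type cylinders cylinders0 cylindersI cylindersD.

End cylinders.

(** * Translating a Laplace law *)

Section laplace_translation.
Context {R : realType}.
Local Notation mu := (@lebesgue_measure R).

Definition translation (t : R) (x : measurableTypeR R) : measurableTypeR R :=
  x + t.

Let measurable_translation t : measurable_fun setT (translation t).
Proof. exact: measurable_funD. Qed.

HB.instance Definition _ t :=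
  isMeasurableFun.Build _ _ _ _ (translation t) (measurable_translation t).

Lemma lebesgue_measure_translation (t : R) (A : set R) : measurable A ->
  pushforward mu (translation t) A = mu A.
Proof.
move=> mA; apply/esym/lebesgue_measure_unique => //= _ [[a b]] _ <-.
rewrite /pushforward/=.
have -> : translation t @^-1` `]a, b] = `]a - t, b - t]%classic.
  by apply/seteqP; split => x /=; rewrite !in_itv/= ltrBlDr lerBrDr.
by rewrite !lebesgue_measure_itv/= !lte_fin ltrD2r -!EFinB opprB addrA subrK.
Qed.

Lemma laplace_pdf_ge0 (x : R) : 0 <= laplace_pdf x.
Proof. by rewrite mulr_ge0 ?invr_ge0 ?sqrtr_ge0 ?expR_ge0. Qed.

Lemma measurable_laplace_pdf (D : set R) : measurable_fun D (@laplace_pdf R).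
Proof.
apply: measurable_funTS; apply: measurable_funM => //.
apply: measurableT_comp => //; apply: measurableT_comp => //.
by apply: measurable_funM => //; exact: measurableT_comp.
Qed.

(** After taking exponents, this is the triangle inequality for [x + t]. *)
Lemma laplace_pdf_translation (t x : R) :
  laplace_pdf x <= expR (Num.sqrt 2 * `|t|) * laplace_pdf (x + t).
Proof.
rewrite /laplace_pdf mulrCA -expRD ler_wpM2l ?invr_ge0 ?sqrtr_ge0//.
rewrite ler_expR -!mulrN -mulrDr ler_wpM2l ?sqrtr_ge0//.
by rewrite lerBrDr addrC lerBlDr [leRHS]addrC ler_normD.
Qed.

Lemma laplace_integral_translation (t : R) (B : set R) : measurable B ->
  (\int[mu]_(x in translation t @^-1` B) (laplace_pdf x)%:E <=
   (expR (Num.sqrt 2 * `|t|))%:E * \int[mu]_(x in B) (laplace_pdf x)%:E)%E.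
Proof.
move=> mB.
have mB' : measurable (translation t @^-1` B).
  by rewrite -[X in measurable X]setTI; exact: measurable_translation.
have mp (D : set R) : measurable_fun D (fun x => (laplace_pdf x)%:E).
  by apply/measurable_EFinP; exact: measurable_laplace_pdf.
(* Translation invariance brings both integrals to the same domain, where the densities compare
   pointwise. *)
have -> : (\int[mu]_(x in B) (laplace_pdf x)%:E =
    \int[mu]_(x in translation t @^-1` B) (laplace_pdf (translation t x))%:E)%E.
  have p0 : {in B, forall y, (0 <= (laplace_pdf y)%:E)%E}.
    by move=> y _; rewrite lee_fin laplace_pdf_ge0.
  have <- := @ge0_integral_pushforward _ _ _ _ _ _ (measurable_translation t) mu
    B _ mB (mp B) p0.
  apply: eq_measure_integral => A mA _; apply/esym.
  exact: lebesgue_measure_translation.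
have mpt : measurable_fun (translation t @^-1` B)
    (fun x => (laplace_pdf (translation t x))%:E).
  apply: measurable_funTS; apply/measurable_EFinP.
  apply: (@measurableT_comp _ _ _ _ _ _ (@laplace_pdf R)).
    exact: measurable_laplace_pdf.
  exact: measurable_translation.
rewrite -ge0_integralZl//; last by move=> x _; rewrite lee_fin laplace_pdf_ge0.
apply: ge0_le_integral => //.
- by move=> x _; rewrite lee_fin laplace_pdf_ge0.
- exact: mp.
- exact: emeasurable_funM.
- by move=> x _; rewrite -EFinM lee_fin laplace_pdf_translation.
Qed.

Lemma laplace_law_affine d (Omega : measurableType d) (P : probability Omega R)
    (Z : Omega -> R) (a b c : R) (B : set R) :
  (forall A : set R, measurable A ->
    P (Z @^-1` A) = (\int[mu]_(x in A) (laplace_pdf x)%:E)%E) ->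
  0 < c -> measurable B ->
  (P [set w | B (a + c * Z w)%R] <=
   (expR (Num.sqrt 2 * (`|a - b| / c)))%:E * P [set w | B (b + c * Z w)%R])%E.
Proof.
move=> PZ c0 mB.
have mE : measurable [set z | B (b + c * z)].
  rewrite -[X in measurable X]setTI.
  suff : measurable_fun setT (fun z : R => b + c * z) by apply.
  by apply: measurable_funD => //; exact: measurable_funM.
(* Moving the centre from [b] to [a] amounts to translating [Z] by [t]. *)
pose t := (a - b) / c.
have abE w : a + c * Z w = b + c * translation t (Z w).
  by rewrite /translation /t; field; rewrite gt_eqF.
have -> : [set w | B (a + c * Z w)] =
    Z @^-1` (translation t @^-1` [set z | B (b + c * z)]).
  by apply/seteqP; split => w /=; rewrite abE.
rewrite -[X in (_ <= _ * P X)%E]/(Z @^-1` [set z | B (b + c * z)]).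
rewrite !PZ//; last first.
  rewrite -[X in measurable X]setTI.
  exact: measurable_translation.
apply: le_trans (laplace_integral_translation _ mE) _.
by rewrite /t normrM normfV (gtr0_norm c0).
Qed.

End laplace_translation.

(** * Coordinates in the orthonormal basis and Borel sets *)

Section coordinates.
Context {R : realType} {H : normedModType R} (ip : H -> H -> R) (phi : nat -> H).
Hypotheses (ipP : is_inner_product ip) (phiP : orthonormal_basis ip phi).

Lemma ipC x y : ip x y = ip y x.
Proof. by case: ipP. Qed.

Lemma ipP_l a x y z : ip (a *: x + y) z = a * ip x z + ip y z.
Proof. by case: ipP. Qed.

Lemma ip_norm x : ip x x = `|x| ^+ 2.
Proof. by case: ipP. Qed.

Lemma ipDl x y z : ip (x + y) z = ip x z + ip y z.
Proof. by rewrite -{1}[x]scale1r ipP_l mul1r. Qed.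

Lemma ip0l z : ip 0 z = 0.
Proof. by apply: (@addrI _ (ip 0 z)); rewrite -ipDl !addr0. Qed.

Lemma ipZl a x z : ip (a *: x) z = a * ip x z.
Proof. by rewrite -[a *: x]addr0 ipP_l ip0l addr0. Qed.

Lemma ipBl x y z : ip (x - y) z = ip x z - ip y z.
Proof. by rewrite ipDl -scaleN1r ipZl mulN1r. Qed.

Lemma ip_suml I (r : seq I) (F : I -> H) z :
  ip (\sum_(i <- r) F i) z = \sum_(i <- r) ip (F i) z.
Proof.
by apply: (big_morph (ip^~ z)) => [x y|]; [exact: ipDl|exact: ip0l].
Qed.

Lemma ip_partial_sum (a : nat -> R) n i :
  ip (\sum_(j < n) a j *: phi j) (phi i) = if (i < n)%N then a i else 0.
Proof.
rewrite ip_suml; under eq_bigr do rewrite ipZl phiP.1.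
case: ltnP => [lin|nli].
  rewrite (bigD1 (Ordinal lin))//= eqxx mulr1 big1 ?addr0// => j ji.
  rewrite (_ : (_ == _) = false) ?mulr0//.
  by apply: contraNF ji => /eqP ji; apply/eqP/val_inj.
by rewrite big1// => j _; rewrite ltn_eqF ?mulr0// (leq_trans (ltn_ord j)).
Qed.

Lemma norm_partial_sum (a : nat -> R) n :
  `|\sum_(j < n) a j *: phi j| ^+ 2 = \sum_(j < n) a j ^+ 2.
Proof.
rewrite -ip_norm ip_suml; apply: eq_bigr => j _.
by rewrite ipZl ipC ip_partial_sum ltn_ord expr2.
Qed.

Lemma normr_basis j : `|phi j| = 1.
Proof.
apply/eqP; rewrite -(@eqrXn2 _ 2)// -ip_norm phiP.1 eqxx expr1n//.
Qed.

(** The difference of the two sides is the squared norm of the residual of [h] after projection on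
    [phi j]. *)
Lemma sqr_ip_le h j : ip h (phi j) ^+ 2 <= `|h| ^+ 2.
Proof.
set a := ip h (phi j); have : 0 <= ip (h - a *: phi j) (h - a *: phi j).
  by rewrite ip_norm sqr_ge0.
rewrite ipBl ipZl ![ip _ (h - _)]ipC !ipBl !ipZl phiP.1 eqxx [ip (phi j) h]ipC.
by rewrite -/a mulr1 subrr mulr0 subr0 ip_norm -expr2 subr_ge0.
Qed.

Lemma ip_le h j : `|ip h (phi j)| <= `|h|.
Proof. by rewrite -ler_sqr ?nnegrE// real_normK ?num_real// sqr_ip_le. Qed.

Lemma continuous_coord j : continuous (fun h => ip h (phi j)).
Proof.
move=> x; apply/cvgrPdist_lt => e e0; apply: filterS (nbhsx_ballx x e e0) => y.
by rewrite -ball_normE/= -ipBl; apply: le_lt_trans; exact: ip_le.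
Qed.

Lemma parseval h : (fun n => \sum_(j < n) ip h (phi j) ^+ 2) @ \oo --> `|h| ^+ 2.
Proof.
under eq_fun do rewrite -(norm_partial_sum (fun j => ip h (phi j))).
have /cvg_norm hh := phiP.2 h.
by rewrite expr2; under eq_fun do rewrite expr2; exact: cvgM.
Qed.

Lemma measurable_norm_coord d (T : measurableType d) (G : T -> H) :
  (forall j, measurable_fun setT (fun w => ip (G w) (phi j))) ->
  measurable_fun setT (fun w => `|G w| ^+ 2).
Proof.
move=> mG.
apply: (@measurable_fun_cvg _ _ _ _ (fun n w => \sum_(j < n) ip (G w) (phi j) ^+ 2)).
  by move=> n; apply: measurable_sum => j; exact: measurable_funX.
by move=> w _; exact: parseval.
Qed.

(** Finite sequences of rationals form a countable type, which makes this family countable. *)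
Definition rat_comb (s : seq rat) : H :=
  \sum_(j < size s) ratr (nth 0 s j) *: phi j.

Lemma rat_comb_dense h (e : R) : 0 < e -> exists s, `|h - rat_comb s| < e.
Proof.
move=> e0; have e20 : 0 < e / 2 by rewrite divr_gt0.
have /cvgrPdist_lt /(_ _ e20)[n _ /(_ n (leqnn n)) /= hn] := phiP.2 h.
(* Half of [e] pays for truncation, the other half for rounding [n] coefficients; [n.+1] keeps the
   divisor nonzero when [n] is 0. *)
have en0 : 0 < e / 2 / n.+1%:R by rewrite divr_gt0.
have /choice[q qP] : forall j, exists q : rat,
    `|ip h (phi j) - ratr q| < e / 2 / n.+1%:R.
  move=> j; set y := ip h (phi j).
  have /rat_in_itvoo[q] : y - e / 2 / n.+1%:R < y + e / 2 / n.+1%:R.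
    by rewrite ltrD2l (lt_trans _ en0)// oppr_lt0.
  by rewrite in_itv/= => yq; exists q; rewrite distrC ltr_distl.
exists (mkseq q n); rewrite /rat_comb size_mkseq.
rewrite -(subrKA (\sum_(j < n) ip h (phi j) *: phi j)).
rewrite (le_lt_trans (ler_normD _ _))// [ltRHS]splitr ltr_leD//.
rewrite -sumrB (le_trans (ler_norm_sum _ _ _))//.
rewrite (@le_trans _ _ (\sum_(j < n) (e / 2 / n.+1%:R)))//.
  apply: ler_sum => j _; rewrite nth_mkseq// -scalerBl normrZ normr_basis mulr1.
  exact: ltW.
rewrite sumr_const card_ord -[leLHS]mulr_natr -[leLHS]mulrA ler_piMr ?(ltW e20)//.
by rewrite mulrC ler_pdivrMr// mul1r ler_nat.
Qed.

Let c j (h : H) : R := ip h (phi j).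

Lemma borel_cylinders : @borel_sets H `<=` <<s cylinders c >>.
Proof.
apply: smallest_sub; first exact: smallest_sigma_algebra.
move=> U /= oU.
pose I := g_sigma_algebraType (cylinders c).
have mc j : measurable_fun [set: I] (c j).
  move=> _ B mB; rewrite setTI; apply: sub_sigma_algebra.
  exact: cylinders_preimage.
(* Balls are written with squared norms because Parseval gives the measurability of the square. *)
pose F (p : seq rat * nat) : set I :=
  [set h : H | `|h - rat_comb p.1| ^+ 2 < p.2.+1%:R^-1 ^+ 2 ].
have mF p : measurable (F p).
  have mN : measurable_fun [set: I] (fun h : I => `|(h : H) - rat_comb p.1| ^+ 2).
    apply: (@measurable_norm_coord _ I (fun h : I => (h : H) - rat_comb p.1)) => j.
    under eq_fun do rewrite ipBl.
    by apply: measurable_funB => //; exact: mc.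
  rewrite -[X in measurable X]setTI.
  by have := mN measurableT _ (measurable_itv `]-oo, (p.2.+1%:R^-1 ^+ 2)%R[);
    rewrite set_itvNyo.
have -> : U = \bigcup_(p in [set p | F p `<=` U]) F p.
  apply/seteqP; split => [h Uh|h [p /= FU]]; last exact: FU.
  have /nbhs_ballP[e /= e0 hU] := open_nbhs_nbhs (conj oU Uh).
  (* The factor 2 bounds the diameter: a ball of radius [k.+1%:R^-1] containing [h] then stays
     within [e] of [h], hence in [U]. *)
  have [k ke] : exists k, 2 * k.+1%:R^-1 < e.
    have e20 : 0 < e / 2 by rewrite divr_gt0.
    have [k _ /(_ k (leqnn k))] := near_infty_natSinv_lt (PosNum e20).
    by move=> /= ke; exists k; rewrite mulrC -ltr_pdivlMr.
  have k0 : 0 < k.+1%:R^-1 :> R by rewrite invr_gt0.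
  have [s hs] := rat_comb_dense h k0.
  exists (s, k) => /=; last by rewrite /F/= ltr_sqr ?nnegrE ?(ltW k0).
  move=> x; rewrite /F/= ltr_sqr ?nnegrE ?(ltW k0)//.
  move=> xs; apply: hU; rewrite -ball_normE/=; apply: le_lt_trans ke.
  rewrite -(subrKA (rat_comb s)) (le_trans (ler_normD _ _))// mulr_natl mulr2n.
  by rewrite lerD// ?ltW// distrC.
(* The union now runs over the whole countable index type, with empty sets at the discarded
   indices. *)
rewrite bigcup_mkcond.
apply: (@countable_bigcupT_measurable _ I) => [|p]; first exact: countableP.
by case: ifP.
Qed.

End coordinates.

(** * From cylinders to laws of random elements *)

Lemma le_measure_ae d (T : measurableType d) (R : realType)
    (m : {measure set T -> \bar R}) (A B : set T) :
  measurable A -> measurable B -> {ae m, forall w, A w -> B w} ->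
  (m A <= m B)%E.
Proof.
move=> mA mB [N [mN N0 ABN]].
apply: (@le_trans _ _ (m (B `|` N))).
  apply: le_measure; rewrite ?inE//; first exact: measurableU.
  move=> w Aw; have [Bw|nBw] := pselect (B w); first by left.
  by right; apply: ABN => /= /(_ Aw).
by rewrite (le_trans (measureU2 _ _ _))// [X in (_ + X <= _)%E]N0 adde0.
Qed.

(** The semiring comparison is applied to the law of [Y] and to [k] times the law of [Y']. *)
Lemma le_pushforward_cylinders d (Omega : measurableType d) (R : realType)
    (P : probability Omega R) d' (T' : measurableType d') (T : pointedType)
    (c : nat -> T -> T') (Y Y' : Omega -> T) (k : {nonneg R}) :
  (forall j, measurable_fun setT (fun w => c j (Y w))) ->
  (forall j, measurable_fun setT (fun w => c j (Y' w))) ->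
  (forall A, cylinders c A -> (P (Y @^-1` A) <= k%:num%:E * P (Y' @^-1` A))%E) ->
  forall A, <<s cylinders c >> A ->
  (P (Y @^-1` A) <= k%:num%:E * P (Y' @^-1` A))%E.
Proof.
move=> mY mY' YY' A mA.
pose I := g_sigma_algebraType (@measurable _ (cylinder_type c)).
have mI (G : Omega -> T) : (forall j, measurable_fun setT (fun w => c j (G w))) ->
    measurable_fun setT (G : Omega -> I).
  move=> mG; apply: (@measurability _ _ Omega I setT G (cylinders c)) => //.
  move=> _ [_ [B [mB _ ->]] <-]; rewrite setTI preimage_bigcap.
  apply: bigcapT_measurable => j.
  by rewrite -[X in measurable X]setTI; apply: (mG j).
pose y : {mfun Omega >-> I} := HB.pack (Y : Omega -> I)
  (isMeasurableFun.Build _ _ _ _ _ (mI _ mY)).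
pose y' : {mfun Omega >-> I} := HB.pack (Y' : Omega -> I)
  (isMeasurableFun.Build _ _ _ _ _ (mI _ mY')).
apply: (@le_measure_semiring _ _ _ (pushforward P y)
  (mscale k (pushforward P y'))) => //.
(* Sigma-finiteness: the whole space is itself a cylinder, of mass [k]. *)
exists (fun=> setT); first by rewrite bigcup_const.
move=> _; split; first exact: cylindersT.
rewrite /semiring_restr/= /mscale/= /pushforward preimage_setT.
by rewrite probability_setT mule1 ltry.
Qed.

Lemma prode_le_expR (R : realType) (s : seq nat) (u v : nat -> \bar R)
    (e : nat -> R) :
  (forall j, 0 <= u j)%E -> (forall j, u j <= (expR (e j))%:E * v j)%E ->
  (\prod_(j <- s) u j <= (expR (\sum_(j <- s) e j))%:E * \prod_(j <- s) v j)%E.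
Proof.
move=> u0 uv; elim: s => [|j s ih]; first by rewrite !big_nil expR0 mule1.
rewrite !big_cons expRD EFinM muleACA lee_pmul//.
by elim/big_ind : _ => // x y x0 y0; exact: mule_ge0.
Qed.

(** * Coordinates of the noise and privacy on cylinders *)

Section iclp.
Context {R : realType} {H : normedModType R} (ip : H -> H -> R) (phi : nat -> H).
Hypotheses (ipP : is_inner_product ip) (phiP : orthonormal_basis ip phi).
Context d (Omega : measurableType d) (P : probability Omega R).

Lemma measurable_coord (X : Omega -> H) j :
  (forall A, borel_sets A -> measurable (X @^-1` A)) ->
  measurable_fun setT (fun w => ip (X w) (phi j)).
Proof.
move=> mX; apply: (measurability _ (RGenOpens.measurableE R)).
move=> _ [_ [x [y ->]] <-]; rewrite setTI.
apply: (mX ((fun h => ip h (phi j)) @^-1` `]x, y[)); apply: sub_sigma_algebra.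
apply: (continuousP _).1; last exact: interval_open.
exact: (continuous_coord ipP phiP).
Qed.

(* The n-th mean square error dominates that of the j-th coordinate as soon as
   j < n, so the latter vanishes. *)
Lemma coord_ae (mu : H) (a : nat -> R) (Z : nat -> Omega -> R) (X : Omega -> H) :
  (forall j, measurable_fun setT (Z j)) ->
  (forall A, borel_sets A -> measurable (X @^-1` A)) ->
  (fun n : nat => (\int[P]_w
    (`|X w - (mu + \sum_(j < n) (a j * Z j w) *: phi j)| ^+ 2)%:E)%E)
    @ \oo --> 0%E ->
  {ae P, forall w, forall j, ip (X w) (phi j) = ip mu (phi j) + a j * Z j w}.
Proof.
move=> mZ mX X0; apply: ae_foralln => j.
pose G n w := X w - (mu + \sum_(j < n) (a j * Z j w) *: phi j).
have GE n i w : ip (G n w) (phi i) =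
    ip (X w) (phi i) - (ip mu (phi i) + if (i < n)%N then a i * Z i w else 0).
  by rewrite (ipBl ipP) (ipDl ipP) (ip_partial_sum ipP phiP (fun i => a i * Z i w)).
have mG n i : measurable_fun setT (fun w => ip (G n w) (phi i)).
  under eq_fun do rewrite GE.
  apply: measurable_funB; first exact: measurable_coord.
  by apply: measurable_funD => //; case: (i < n)%N => //; exact: measurable_funM.
(* [j.+1] is the first length whose partial sum contains the term of index [j]; longer sums leave
   this coordinate of the error unchanged. *)
pose g w := ip (G j.+1 w) (phi j).
have mg : measurable_fun setT (fun w => (g w ^+ 2)%:E).
  by apply/measurable_EFinP; apply: (@measurable_funX _ _ _ _ g 2); exact: mG.
have g0 : (\int[P]_w `|(g w ^+ 2)%:E| = 0)%E.
  apply/eqP; rewrite eq_le integral_ge0// andbT.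
  rewrite -(cvg_lim _ X0)//; apply: lime_ge; first by apply/cvg_ex; exists 0%E.
  exists j.+1 => // n /= jn; apply: ge0_le_integral => //.
  - exact: (@measurableT_comp _ _ _ _ _ _ (@abse R) _ (EFin \o _)).
  - by apply/measurable_EFinP; exact: (measurable_norm_coord ipP phiP (mG n)).
  - move=> w _; rewrite lee_fin ger0_norm ?sqr_ge0//.
    rewrite (_ : g w = ip (G n w) (phi j)) ?(sqr_ip_le ipP phiP)//.
    by rewrite /g !GE ltnSn jn.
have [/(_ g0) + _] := ae_eq_integral_abs P measurableT mg.
apply: filterS => w /(_ I)[/eqP]; rewrite sqrf_eq0 /g GE ltnSn subr_eq0.
by move/eqP.
Qed.

(** Only finitely many sides of a cylinder are nontrivial, so independence factors its probability
    into a finite product. Changing the centre costs one exponential per factor, and the exponents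
    add up to at most [k]. *)
Lemma le_laplace_cylinders (a : nat -> R) (Z : nat -> Omega -> R) (X : Omega -> H)
    (u v : H) (k : R) :
  (forall j, 0 < a j) ->
  (forall j, measurable_fun setT (Z j)) ->
  mutually_independent P Z ->
  (forall j (A : set R), measurable A ->
    P (Z j @^-1` A) = (\int[lebesgue_measure]_(x in A) (laplace_pdf x)%:E)%E) ->
  (forall j, measurable_fun setT (fun w => ip (X w) (phi j))) ->
  {ae P, forall w, forall j, ip (X w) (phi j) = a j * Z j w} ->
  (forall n, \sum_(j < n) Num.sqrt 2 * (`|ip (u - v) (phi j)| / a j) <= k) ->
  forall A, cylinders (fun j h => ip h (phi j)) A ->
  (P ((fun w => (u + X w)%R) @^-1` A) <=
   (expR k)%:E * P ((fun w => (v + X w)%R) @^-1` A))%E.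
Proof.
move=> a0 mZ indZ lawZ mX XZ uvk _ [B [mB [n Bn] ->]].
pose E (h : H) j := [set z : R | B j (ip h (phi j) + a j * z)].
have mE h j : measurable (E h j).
  rewrite -[X in measurable X]setTI.
  suff : measurable_fun setT (fun z : R => ip h (phi j) + a j * z) by apply.
  by apply: measurable_funD => //; exact: measurable_funM.
have mZE h j : measurable (Z j @^-1` E h j).
  by rewrite -[X in measurable X]setTI; exact: (mZ j measurableT _ (mE h j)).
pose s := index_iota 0 n.
have PE h : P ((fun w => h + X w) @^-1` (\bigcap_j ((ip^~ (phi j)) @^-1` B j))) =
    (\prod_(j <- s) P (Z j @^-1` E h j))%E.
  rewrite -indZ ?iota_uniq//.
  have m1 : measurable
      ((fun w => h + X w) @^-1` (\bigcap_j ((ip^~ (phi j)) @^-1` B j))).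
    rewrite preimage_bigcap; apply: bigcapT_measurable => j.
    rewrite -[X in measurable X]setTI.
    suff : measurable_fun setT (fun w => ip (h + X w) (phi j)) by apply.
    by under eq_fun do rewrite (ipDl ipP); exact: measurable_funD.
  have m2 : measurable (\bigcap_(i in [set` s]) (Z i @^-1` E h i)).
    exact: bigcap_measurableType.
  (* The two events coincide only almost everywhere, as the coordinates of [X] are known only
     there. *)
  apply/eqP; rewrite eq_le; apply/andP; split; apply: le_measure_ae => //.
    apply: filterS XZ => w wE Bw j _.
    by have := Bw j I; rewrite /preimage/= (ipDl ipP) wE.
  apply: filterS XZ => w wE Bw j _; rewrite /preimage/= (ipDl ipP) wE.
  have [nj|jn] := leqP n j; first by rewrite Bn.
  by apply: (Bw j); rewrite /= mem_index_iota.
rewrite !PE; apply: le_trans.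
  apply: (prode_le_expR _ _ (v := fun j => P (Z j @^-1` E v j))
    (e := fun j => Num.sqrt 2 * (`|ip u (phi j) - ip v (phi j)| / a j))) => // j.
  exact: (laplace_law_affine (ip u (phi j)) (ip v (phi j)) (lawZ j)).
apply: lee_wpmul2r.
  by elim/big_ind : _ => // x y x0 y0; exact: mule_ge0.
rewrite lee_fin ler_expR (le_trans _ (uvk n))// /s big_mkord.
by under eq_bigr do rewrite -(ipBl ipP).
Qed.

End iclp.

(** * Calibration of the noise to the sensitivity *)

Theorem theorem4 (R : realType) (H : completeNormedModType R)
  (ip : H -> H -> R) (C : H -> H) (lam : nat -> R) (phi : nat -> H)
  (d : measure_display) (Omega : measurableType d) (P : probability Omega R)
  (Rec : Type) (Dom : set (seq Rec)) (f : seq Rec -> H)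
  (eps : R) (Z : Omega -> H) :
  is_inner_product ip ->
  covariance_operator_eigen ip C lam phi ->
  (forall D, Dom D -> (norm1C ip lam phi (f D) < +oo)%E) ->
  (0 < sensitivity ip lam phi Dom f)%E ->
  (sensitivity ip lam phi Dom f < +oo)%E ->
  0 < eps ->
  is_ICLP P 0 lam phi Z ->
  let sigma := Num.sqrt 2 * fine (sensitivity ip lam phi Dom f) / eps in
  forall D D', Dom D -> Dom D' -> adjacent_datasets D D' ->
  forall A : set H, borel_sets A ->
    (P ((fun w => (f D + sigma *: Z w)%R) @^-1` A)
     <= (expR eps)%:E * P ((fun w => (f D' + sigma *: Z w)%R) @^-1` A))%E.
Proof.
move=> ipP [_ phiP _ [lam0 _] _] _ S0 Soo eps0 [z [mz indz lawz mZ Z0]] sigma.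
move=> D D' domD domD' DD' A bA.
set S := sensitivity _ _ _ _ _ in S0 Soo sigma *.
(* Finiteness makes [fine S] the true sensitivity rather than the default value 0. *)
have Sfin : S \is a fin_num by rewrite ge0_fin_numE// ltW.
have fS0 : 0 < fine S by rewrite fine_gt0// S0 Soo.
have sq2 : 0 < Num.sqrt 2 :> R by rewrite sqrtr_gt0.
have sigma0 : 0 < sigma by rewrite divr_gt0// mulr_gt0.
have mcoord j : measurable_fun setT (fun w => ip (Z w) (phi j)).
  exact: (measurable_coord ipP phiP).
have mscoord j : measurable_fun setT (fun w => ip (sigma *: Z w) (phi j)).
  by under eq_fun do rewrite (ipZl ipP); exact: measurable_funM.
have mshift h j : measurable_fun setT (fun w => ip (h + sigma *: Z w) (phi j)).
  by under eq_fun do rewrite (ipDl ipP); exact: measurable_funD.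
apply: (@le_pushforward_cylinders _ _ _ P _ _ _ (fun j h => ip h (phi j)) _ _
  (NngNum (expR_ge0 eps))) => //; last exact: (borel_cylinders ipP phiP).
have a0 j : 0 < sigma * Num.sqrt (lam j) by rewrite mulr_gt0// sqrtr_gt0.
apply: (le_laplace_cylinders ipP a0 mz indz lawz mscoord).
  have := coord_ae (a := fun j => Num.sqrt (lam j)) ipP phiP mz mZ Z0.
  apply: filterS => w wE j.
  by rewrite (ipZl ipP) wE (ip0l ipP) add0r mulrA.
move=> n; set w := fun j => `|ip (f D - f D') (phi j)| / Num.sqrt (lam j).
(* A partial sum is at most the full weighted norm, which is one of the values in the supremum
   [S]. *)
have wS : \sum_(j < n) w j <= fine S.
  rewrite -lee_fin fineK// -sumEFin.
  apply: (@le_trans _ _ (norm1C ip lam phi (f D - f D'))).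
    rewrite /norm1C -(big_mkord xpredT (fun j => (w j)%:E)).
    by apply: nneseries_lim_ge => j _ _; rewrite lee_fin divr_ge0 ?sqrtr_ge0.
  by apply: ereal_sup_ubound; exists D, D'.
(* This is the choice of [sigma] solved for [eps]; the constant [Num.sqrt 2 / sigma] then factors
   out of the sum of exponents. *)
rewrite (_ : eps = Num.sqrt 2 / sigma * fine S); last first.
  by rewrite /sigma; field; rewrite !gt_eqF.
apply: le_trans (ler_wpM2l _ wS); last by rewrite ltW// divr_gt0.
rewrite mulr_sumr ler_sum// => j _; rewrite /w.
by rewrite invfM [leRHS]mulrACA [leLHS]mulrA.
Qed.
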